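(* Let $m$ be a non-negative integer. Then $$\sum_{\substack{(y_1,\ldots,y_m)\\ \sum i y_i=m}}\prod_{i=1}^{m}\frac{(-1)^{y_i}}{i^{y_i}\,y_i!}=\sum_{\substack{(y_1,\ldots,y_m)\\ \sum i y_i=m}}(-1)^{\sum y_i}\prod_{i=1}^{m}\frac{1}{i^{y_i}\,y_i!}=\begin{cases}(-1)^m & \text{for } 0\le m\le 1,\\ 0 & \text{for } m\ge 2,\end{cases}$$ where the sums run over all partitions of $m$.
   Context: A partition of $m$ is represented by the tuple $(y_1,\ldots,y_m)$ of non-negative integers with $\sum_{i=1}^m i\,y_i=m$, and $\sum y_i$ denotes $\sum_{i=1}^m y_i$. For $m=0$ there is exactly one partition, the empty one. Empty products equal $1$. *)

(* Defs.v *)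
From mathcomp Require Import all_boot all_order all_algebra.

Set Implicit Arguments.
Unset Strict Implicit.
Unset Printing Implicit Defensive.

(* The ordinal i : 'I_m stands for the part size i.+1, so [y i] is the
   multiplicity y_(i+1).  Bounding the multiplicities by m loses no partition:
   see [partitionsP]. *)
Definition partitions (m : nat) : {set {ffun 'I_m -> 'I_m.+1}} :=
  [set y : {ffun 'I_m -> 'I_m.+1} | \sum_(i < m) i.+1 * y i == m].

Lemma partitionsP (m : nat) (y : 'I_m -> nat) :
  \sum_(i < m) i.+1 * y i = m <->
  exists2 z : {ffun 'I_m -> 'I_m.+1}, z \in partitions m & forall i, z i = y i :> nat.
Proof.
split=> [ym | [z]]; last first.
  by rewrite inE => /eqP zm zy; rewrite -[RHS]zm; apply: eq_bigr => i _; rewrite zy.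
have le_y i : y i < m.+1.
  rewrite ltnS -[leqRHS]ym (bigD1 i) //=.
  by apply: leq_trans (leq_addr _ _); rewrite leq_pmull.
exists [ffun i => Ordinal (le_y i)] => [|i]; last by rewrite ffunE.
by rewrite inE -[eqbRHS]ym; apply/eqP/eq_bigr => i _; rewrite ffunE.
Qed.

(* Main.v *)
Require Import Defs.
From mathcomp Require Import all_boot all_order all_algebra.
From mathcomp Require Import ring.

(** The sum is the coefficient of [x ^ m] in
    [exp (- x - x^2/2 - x^3/3 - ...) = exp (ln (1 - x)) = 1 - x].

    To stay within polynomials over the rationals, each factor
    [exp (- x^i/i)] is cut after [m + 1] terms and only the factors with
    [i <= m] are kept. Expanding the product [P] of these factors, the
    coefficient of [x ^ m] is the sum over the partitions of [m]
    ([sum_partitions_coef]).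
    Instead of composing exponential and logarithm, one compares differential
    equations: each factor satisfies [E' = - x^(i-1) E] modulo [x ^ m]
    ([deriv_exp_part]), hence [P' = - (1 + x + ... + x^(m-1)) P], that is
    [(1 - x) P' = - P] modulo [x ^ m]. On coefficients this reads
    [(k + 1) p_(k+1) = (k - 1) p_k] for [k < m] ([coef_recurrence]); with
    [p_0 = 1] it gives [p_1 = -1], then [p_2 = 0] because of the factor
    [k - 1], and all later coefficients vanish. *)

Import Order.TTheory GRing.Theory Num.Theory.
Local Open Scope ring_scope.

Definition part_weight (i j : nat) : rat :=
  (-1) ^+ j / (i.+1%:R ^+ j * j`!%:R).

(** The exponential [exp (- x^(i+1) / (i+1))], cut after the power [N] of its
    argument. As in the index type of partitions, [i] stands for the part size
    [i.+1]. *)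
Definition exp_part (N i : nat) : {poly rat} :=
  \sum_(j < N.+1) part_weight i j *: 'X^(i.+1 * j).

Definition exp_prod (N : nat) : {poly rat} := \prod_(i < N) exp_part N i.

Lemma part_weightS (i j : nat) :
  part_weight i j.+1 *+ (i.+1 * j.+1) = - part_weight i j.
Proof.
rewrite -[LHS]mulr_natr /part_weight factS !natrM !exprS.
by field; rewrite !nat1r expf_eq0 !pnatr_eq0 -lt0n fact_gt0 andbF.
Qed.

(** Term [j + 1] of the derivative cancels term [j] of the exponential times
    [x ^ i]. Only the image of the last term [j = N] of the cut exponential
    survives, and its degree [i + (i + 1) N] is at least [N]. *)
Lemma deriv_exp_part (N i : nat) :
  'X^N %| (exp_part N i)^`() + 'X^i * exp_part N i.
Proof.
rewrite {1}/exp_part big_ord_recl muln0 derivD derivZ derivXn mulr0n scaler0.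
rewrite add0r raddf_sum /= {1}/exp_part big_ord_recr /= mulrDr mulr_sumr addrA.
rewrite -big_split big1 => [|j _] /=; last first.
  rewrite derivZ derivXn -scalerMnr scalerMnl part_weightS.
  by rewrite -scalerAr -exprD mulnS scaleNr addNr.
rewrite add0r -scalerAr -exprD dvdpZr; last first.
  rewrite mulf_neq0 ?signr_eq0 // invr_eq0 mulf_neq0 ?pnatr_eq0 //.
    by rewrite expf_neq0 // pnatr_eq0.
  by rewrite -lt0n fact_gt0.
by rewrite dvdp_exp2l // mulSn addnCA leq_addr.
Qed.

(** Logarithmic derivatives of a product add up, also modulo [d]. *)
Lemma dvdp_deriv_prod (I : Type) (r : seq I) (d : {poly rat})
    (E a : I -> {poly rat}) :
    (forall i, d %| (E i)^`() + a i * E i) ->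
  d %| (\prod_(i <- r) E i)^`() + (\sum_(i <- r) a i) * \prod_(i <- r) E i.
Proof.
move=> dE; elim: r => [|i r IHr]; first by rewrite !big_nil derivC mul0r addr0 dvdp0.
rewrite !big_cons derivM; set P := \prod_(_ <- _) _; set s := \sum_(_ <- _) _.
have -> : (E i)^`() * P + E i * P^`() + (a i + s) * (E i * P)
          = ((E i)^`() + a i * E i) * P + E i * (P^`() + s * P) by ring.
by apply: dvdp_add; [exact: dvdp_mulr | exact: dvdp_mull].
Qed.

(** Multiplying the differential equation by [1 - x] collapses the geometric
    sum [1 + x + ... + x^(N-1)] to [1] modulo [x ^ N]. *)
Lemma deriv_exp_prod (N : nat) :
  'X^N %| (1 - 'X) * (exp_prod N)^`() + exp_prod N.
Proof.
have /(dvdp_mull (1 - 'X)) :=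
  dvdp_deriv_prod _ (index_enum 'I_N) _ _ _ (deriv_exp_part N).
rewrite -/(exp_prod N); set P := exp_prod N; set s := \sum_(_ <- _) _.
have geom : (1 - 'X) * s = 1 - 'X^N.
  by rewrite -[1 - 'X]opprB mulNr /s -subrX1 opprB.
rewrite mulrDr [X in _ + X]mulrA geom [X in _ + X]mulrBl mul1r addrA => dvdN.
by rewrite -(dvdp_addl _ (_ : 'X^N %| - ('X^N * P))) ?dvdpNr ?dvdp_mulr.
Qed.

Lemma coef_recurrence (N k : nat) : (k < N)%N ->
  k.+1%:R * (exp_prod N)`_k.+1 = (k%:R - 1) * (exp_prod N)`_k.
Proof.
move=> ltkN; have /dvdpP[q /(congr1 (coefp k))] := deriv_exp_prod N.
rewrite /= coefMXn ltkN coefD mulrBl mul1r coefB coefXM !coef_deriv.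
have -> : (if k == 0%N then 0 else (exp_prod N)`_k.-1.+1 *+ k.-1.+1)
          = k%:R * (exp_prod N)`_k.
  by case: k {ltkN} => [|k] /=; rewrite ?mul0r // mulr_natl.
by rewrite -addrA => /eqP; rewrite addr_eq0 => /eqP pk1; rewrite mulr_natl pk1; ring.
Qed.

Lemma exp_prod0 (N : nat) : (exp_prod N)`_0 = 1.
Proof.
rewrite -horner_coef0 horner_prod big1 // => i _.
rewrite horner_sum big_ord_recl big1 => [|j _]; last first.
  by rewrite hornerZ hornerXn expr0n muln_eq0 mulr0.
by rewrite hornerZ hornerXn muln0 /part_weight !expr0 fact0 addr0 !mulr1.
Qed.

Lemma coef_exp_prod (N k : nat) : (k <= N)%N ->
  (exp_prod N)`_k = if (k <= 1)%N then (-1) ^+ k else 0.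
Proof.
elim: k => [|k IHk] ltkN; first by rewrite exp_prod0.
have := coef_recurrence _ _ ltkN; rewrite IHk ?(ltnW ltkN) //.
have k1_neq0 : k.+1%:R != 0 :> rat by rewrite pnatr_eq0.
move=> e; apply: (mulfI k1_neq0); rewrite e {IHk ltkN e}.
by case: k k1_neq0 => [|[|k]] _ //=; rewrite !mulr0.
Qed.

(** Choosing a term in each factor is choosing the multiplicity of each part
    size. *)
Lemma sum_partitions_coef (m : nat) :
  \sum_(y in partitions m) \prod_(i < m) part_weight i (y i) = (exp_prod m)`_m.
Proof.
rewrite /exp_prod bigA_distr_bigA coef_sum /= big_mkcond /=.
apply: eq_bigr => y _; rewrite inE scaler_prod.
have -> : \prod_(i < m) 'X^(i.+1 * y i) = 'X^(\sum_(i < m) i.+1 * y i) :> {poly rat}.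
  by rewrite expr_sum.
by rewrite coefZ coefXn eq_sym; case: eqP; rewrite ?mulr1 ?mulr0.
Qed.

Theorem lemma3p1 (m : nat) :
  \sum_(y in partitions m)
     \prod_(i < m) ((-1) ^+ y i / (i.+1%:R ^+ y i * (y i)`!%:R))
  = \sum_(y in partitions m)
     ((-1) ^+ (\sum_(i < m) y i)%N *
      \prod_(i < m) (1 / (i.+1%:R ^+ y i * (y i)`!%:R))) :> rat
  /\
  \sum_(y in partitions m)
     ((-1) ^+ (\sum_(i < m) y i)%N *
      \prod_(i < m) (1 / (i.+1%:R ^+ y i * (y i)`!%:R)))
  = (if (m <= 1)%N then (-1) ^+ m else 0) :> rat.
Proof.
have signs_in (y : {ffun 'I_m -> 'I_m.+1}) :
    (-1) ^+ (\sum_(i < m) y i)%N *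
      \prod_(i < m) (1 / (i.+1%:R ^+ y i * (y i)`!%:R))
    = \prod_(i < m) part_weight i (y i).
  by rewrite expr_sum -big_split; apply: eq_bigr => i _; rewrite /= div1r.
split; first by apply: eq_bigr => y _; rewrite signs_in.
rewrite -(coef_exp_prod m) // -sum_partitions_coef.
by apply: eq_bigr => y _; rewrite signs_in.
Qed.
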